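(* Let $Z$ be the zebra cylinder associated with a strictly decreasing sequence $(d_n)_{n\in\mathbb N}$ in $[0,1]$ with infimum $0$, and let $i_0,c_0:S^1\to Z$ be the morphisms $i_0(s)=(s,0)$ and $c_0(s)=(1,0)$. The pair $(i_0,c_0)$ does not have any coequalizer in the category of locally ordered spaces, nor in any of its variants obtained by requiring the objects to satisfy any combination of the properties: strictly locally ordered, locally Nachbin ordered, Hausdorff (eight categories in total).
   Context: **Locally ordered spaces.** For posets $B,B'$ write $B\subset_{lax}B'$ when $|B|\subset|B'|$ and $p\leq_B q$ implies $p\leq_{B'}q$ for all $p,q\in B$; write $B\subset_{str}B'$ when $|B|\subset |B'|$ and $\leq_B$ is the restriction of $\leq_{B'}$ to $B$. An *ordered basis* on a topological space $X$ is a set $\mathfrak B$ of posets whose underlying sets form a basis of the topology of $X$ and such that for all $x\in X$ and $B,B'\in\mathfrak B$ with $x\in B\cap B'$ there is $B''\in\mathfrak B$ with $x\in B''$, $B''\subset_{lax}B$ and $B''\subset_{lax}B'$. It is *strict* if one can always find such $B''$ with $B''\subset_{str}B$ and $B''\subset_{str}B'$. An ordered basis $\mathfrak B'$ is *coarser* than $\mathfrak B$ if for every $x\in X$ and every $B'\in\mathfrak B'$ with $x\in B'$ there is $B\in\mathfrak B$ with $x\in B\subset_{lax}B'$; two ordered bases are *equivalent* if each is coarser than the other. A *locally ordered space* is a topological space with an equivalence class of ordered bases; it is a *strictly* locally ordered space if the class contains a strict basis, and Hausdorff if its underlying topological space is. Its *open posets* are the posets $A$ with $|A|\subset X$ such that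 for every $x\in A$ there is $B\in\mathfrak B$ with $x\in B\subset_{lax}A$ (for $\mathfrak B$ any basis in the class); the set of open posets is denoted $\overrightarrow{\mathcal O}(X)$. **Nachbin.** A *Nachbin ordered space* is a topological space $P$ with a partial order that is closed in $P\times P$. A locally ordered space $X$ is *locally Nachbin ordered* if for all $x\in X$ and $O\in\overrightarrow{\mathcal O}(X)$ with $x\in O$ there is $O'\in\overrightarrow{\mathcal O}(X)$ with $x\in O'\subset_{lax}O$ that is a Nachbin ordered space for the topology inherited from $X$. **Morphisms.** A map $f:X\to Y$ between locally ordered spaces with ordered bases $\mathfrak B,\mathfrak B'$ is *locally increasing at* $x$ if for all $B'\in\mathfrak B'$ with $f(x)\in B'$ there is $B\in\mathfrak B$ with $x\in B$, $f(B)\subset B'$ and $f:B\to B'$ increasing (independent of the bases in the classes). The morphisms of all the categories considered are the maps that are locally increasing at every point. **Circle.** $S^1=\{z\in\mathbb C:|z|=1\}$. A *proper open arc* is a set $\alpha=\{e^{ix}: x\in{]a,b[}\}$ with $0<b-a<2\pi$; its standard order $\leq_\alpha$ is $e^{ix}\leq_\alpha e^{iy}$ iff $x\leq y$, for $x,y\in{]a,b[}$. As a locally ordered space, $S^1$ is the *unordered circle*: its ordered basis is the set of proper open arcs ordered by equality. **Zebra cylinder.** Let $I=[0,1]$, $\overline{\mathbb N}=\mathbb N\sqcup\{+\infty\}$, and let $(d_n)_{n\in\mathbb N}$ be a strictly decreasing sequence in $I$ with $\inf_n d_n=0$. Put $I(n)=[d_{2n+1},d_{2n}]$ for $n\in\mathbb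 N$ and $I(+\infty)=\{0\}$. $Z$ is the topological space $S^1\times I$ with the ordered basis consisting of the sets $\alpha\times O$, $\alpha$ a proper open arc and $O$ an open subset of $I$, ordered by: $(s,u)\preceq^O_\alpha(s',u')$ iff either $s\leq_\alpha s'$ and $u=u'\in I(n)$ for some $n\in\overline{\mathbb N}$, or $s=s'$ and $u=u'$. (It is a strictly locally Nachbin ordered Hausdorff space.) *)

(* Defs.v *)
From HB Require Import structures.
From mathcomp Require Import all_boot all_order all_algebra.
From mathcomp Require Import all_classical all_reals all_analysis.
From mathcomp Require Import complex ring lra zify.
Set Implicit Arguments.
Unset Strict Implicit.
Unset Printing Implicit Defensive.
Import Order.TTheory GRing.Theory Num.Theory numFieldNormedType.Exports.
Local Open Scope classical_set_scope.
Local Open Scope ring_scope.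

(* [sle_carrier] makes [sle] a relation on [carrier], so that a poset with      *)
(* underlying set in X has exactly one representation.                          *)
Record subposet (X : Type) := Subposet {
  carrier : set X;
  sle : X -> X -> Prop;
  sle_carrier : forall p q, sle p q -> carrier p /\ carrier q;
  sle_refl : forall p, carrier p -> sle p p;
  sle_anti : forall p q, sle p q -> sle q p -> p = q;
  sle_trans : forall q p r, sle p q -> sle q r -> sle p r }.

Definition sub_lax (X : Type) (B B' : subposet X) : Prop :=
  carrier B `<=` carrier B' /\ forall p q, sle B p q -> sle B' p q.

Definition sub_str (X : Type) (B B' : subposet X) : Prop :=
  carrier B `<=` carrier B' /\
  forall p q, carrier B p -> carrier B q -> (sle B p q <-> sle B' p q).

Definition ordered_basis (X : topologicalType) (BB : set (subposet X)) : Prop :=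
  basis [set carrier B | B in BB] /\
  forall x B B', BB B -> BB B' -> carrier B x -> carrier B' x ->
    exists B'', [/\ BB B'', carrier B'' x, sub_lax B'' B & sub_lax B'' B'].

Definition strict_ordered_basis (X : topologicalType)
    (BB : set (subposet X)) : Prop :=
  ordered_basis BB /\
  forall x B B', BB B -> BB B' -> carrier B x -> carrier B' x ->
    exists B'', [/\ BB B'', carrier B'' x, sub_str B'' B & sub_str B'' B'].

Definition coarser (X : Type) (BB' BB : set (subposet X)) : Prop :=
  forall x B', BB' B' -> carrier B' x ->
    exists B, [/\ BB B, carrier B x & sub_lax B B'].

Definition equivalent_bases (X : Type) (BB BB' : set (subposet X)) : Prop :=
  coarser BB BB' /\ coarser BB' BB.

Definition basis_class (X : topologicalType) (BB : set (subposet X)) :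
    set (set (subposet X)) :=
  [set BB' | ordered_basis BB' /\ equivalent_bases BB BB'].

Record lospace := Lospace {
  lo_space :> topologicalType;
  lo_bases : set (set (subposet lo_space));
  lo_basesP : exists2 BB, ordered_basis BB & lo_bases = basis_class BB }.

Definition lospace_of (X : topologicalType) (BB : set (subposet X))
    (hBB : ordered_basis BB) : lospace :=
  @Lospace X (basis_class BB) (ex_intro2 _ _ BB hBB erefl).

Definition open_poset (X : lospace) (A : subposet X) : Prop :=
  forall BB, lo_bases BB -> forall x, carrier A x ->
    exists B, [/\ BB B, carrier B x & sub_lax B A].

Definition strictly_lo (X : lospace) : Prop :=
  exists2 BB, @lo_bases X BB & strict_ordered_basis BB.

Definition nachbin_ordered (P : topologicalType) (le : P -> P -> Prop) : Prop :=
  [/\ forall p, le p p,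
      forall p q, le p q -> le q p -> p = q,
      forall q p r, le p q -> le q r -> le p r &
      closed [set z : P * P | le z.1 z.2]].

(* [set_type A] carries the topology induced by the ambient space. *)
Definition nachbin_subposet (X : topologicalType) (A : subposet X) : Prop :=
  @nachbin_ordered (set_type (carrier A)) (fun p q => sle A (\val p) (\val q)).

Definition locally_nachbin (X : lospace) : Prop :=
  forall (x : X) (O : subposet X), open_poset O -> carrier O x ->
    exists O', [/\ open_poset O', carrier O' x, sub_lax O' O &
                   nachbin_subposet O'].

Definition locally_increasing_at (X Y : lospace) (f : X -> Y) (x : X) : Prop :=
  forall BX BY, lo_bases BX -> lo_bases BY ->
  forall B', BY B' -> carrier B' (f x) ->
    exists B, [/\ BX B, carrier B x, f @` carrier B `<=` carrier B' &
                  forall p q, sle B p q -> sle B' (f p) (f q)].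

Record lomorphism (X Y : lospace) := Lomorphism {
  lo_map :> X -> Y;
  lo_mapP : forall x, locally_increasing_at lo_map x }.

(* The eight categories are full subcategories of the category of locally      *)
(* ordered spaces; they are given by their classes of objects.                  *)
Definition lo_category (strict nachbin hausdorff : bool) (X : lospace) : Prop :=
  [/\ strict -> strictly_lo X, nachbin -> locally_nachbin X &
      hausdorff -> hausdorff_space X].

Definition is_coequalizer (C : lospace -> Prop) (X Y : lospace)
    (f g : lomorphism X Y) (Q : lospace) (q : lomorphism Y Q) : Prop :=
  [/\ C Q, q \o f =1 q \o g &
      forall (W : lospace) (h : lomorphism Y W), C W -> h \o f =1 h \o g ->
        exists! k : lomorphism Q W, k \o q =1 h].

Lemma sub_lax_refl (X : Type) (B : subposet X) : sub_lax B B.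
Proof. by split. Qed.

Lemma sub_lax_trans (X : Type) (B A C : subposet X) :
  sub_lax A B -> sub_lax B C -> sub_lax A C.
Proof. by move=> [ab ab'] [bc bc']; split=> [x /ab/bc //|p q /ab'/bc']. Qed.

Lemma sub_str_lax (X : Type) (A B : subposet X) : sub_str A B -> sub_lax A B.
Proof.
move=> [AB h]; split=> // p q pq; have [Ap Aq] := sle_carrier pq.
exact/(h p q Ap Aq).
Qed.

Lemma coarser_trans (X : Type) (B2 B1 B3 : set (subposet X)) :
  coarser B1 B2 -> coarser B2 B3 -> coarser B1 B3.
Proof.
move=> h12 h23 x B' /h12 h /h [B [/h23 k /k [A [B3A Ax AB]] BB']].
by exists A; split=> //; exact: sub_lax_trans AB BB'.
Qed.

Lemma coarser_refl (X : Type) (BB : set (subposet X)) : coarser BB BB.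
Proof. by move=> x B BB_B Bx; exists B; split=> //; exact: sub_lax_refl. Qed.

Lemma lo_bases_coarser (X : lospace) (BB BB' : set (subposet X)) :
  lo_bases BB -> lo_bases BB' -> coarser BB BB'.
Proof.
case: (lo_basesP X) => B0 _ -> [_ [_ h1]] [_ [h2 _]].
exact: coarser_trans h1 h2.
Qed.

Lemma lo_bases_of (X : topologicalType) (BB : set (subposet X))
  (hBB : ordered_basis BB) : @lo_bases (lospace_of hBB) BB.
Proof. by split=> //; split; exact: coarser_refl. Qed.

Lemma open_posetE (X : lospace) (BB : set (subposet X)) (A : subposet X) :
  lo_bases BB ->
  open_poset A <-> forall x, carrier A x ->
    exists B, [/\ BB B, carrier B x & sub_lax B A].
Proof.
move=> BBX; split=> [|h BB' BB'X x /h [B [BB_B Bx BA]]]; first exact.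
have [B' [BB'B' B'x B'B]] := lo_bases_coarser BBX BB'X BB_B Bx.
by exists B'; split=> //; exact: sub_lax_trans B'B BA.
Qed.

Lemma locally_increasing_atE (X Y : lospace) (f : X -> Y) (x : X)
    (BX : set (subposet X)) (BY : set (subposet Y)) :
  lo_bases BX -> lo_bases BY ->
  locally_increasing_at f x <->
  forall B', BY B' -> carrier B' (f x) ->
    exists B, [/\ BX B, carrier B x, f @` carrier B `<=` carrier B' &
                  forall p q, sle B p q -> sle B' (f p) (f q)].
Proof.
move=> BXX BYY; split=> [|h BX' BY' BX'X BY'Y B' BY'B' B'fx]; first exact.
have [A' [BYA' A'fx A'B']] := lo_bases_coarser BY'Y BYY BY'B' B'fx.
have [A [BXA Ax fA fle]] := h A' BYA' A'fx.
have [B [BX'B Bx BA]] := lo_bases_coarser BXX BX'X BXA Ax.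
exists B; split=> //.
  by move=> _ [p Bp <-]; apply: A'B'.1; apply: fA; exists p => //; exact: BA.1.
by move=> p q /BA.2/fle; exact: A'B'.2.
Qed.

(* R[i]^o is the field R[i] of complex numbers with its norm topology.          *)
Definition circle (R : realType) : set R[i]^o := [set z | `|z| = 1].
Arguments circle R : clear implicits.

Definition expi (R : realType) (t : R) : R[i]^o := Complex (cos t) (sin t).

Lemma expi_circle (R : realType) (t : R) : expi t \in circle R.
Proof. by apply: mem_set; rewrite /circle /= normc_def /= cos2Dsin2 sqrtr1. Qed.

Definition circle_pt (R : realType) (t : R) : circle R :=
  exist _ (expi t) (expi_circle t).

Definition circle_arc (R : realType) (a b : R) : set (circle R) :=
  [set circle_pt x | x in `]a, b[].

Definition proper_arc (R : realType) (a b : R) : Prop := 0 < b - a < 2 * pi.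

Lemma circle_ptP (R : realType) (x y : R) :
  circle_pt x = circle_pt y <-> cos x = cos y /\ sin x = sin y.
Proof.
split=> [/(congr1 \val) [-> ->]//|[cxy sxy]].
by apply: val_inj; rewrite /= /expi cxy sxy.
Qed.

Lemma circle_ptD (R : realType) (h x y : R) :
  circle_pt x = circle_pt y -> circle_pt (x + h) = circle_pt (y + h).
Proof. by move=> /circle_ptP[c s]; apply/circle_ptP; rewrite !cosD !sinD c s. Qed.

Lemma circle_pt_inj (R : realType) (x y : R) :
  `|x - y| < 2 * pi -> circle_pt x = circle_pt y -> x = y.
Proof.
move=> xy /circle_ptP[c s]; set u := `|x - y| in xy.
have cu : cos u = 1.
  by rewrite /u cos_norm cosB c s -!expr2 cos2Dsin2.
have u2 : u = (u / 2) *+ 2 by rewrite -mulr_natr mulfVK.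
have su : sin (u / 2) = 0.
  apply/eqP; rewrite -sqrf_eq0 sin2cos2.
  by move: cu; rewrite u2 cos_mulr2n => cu; apply/eqP; rewrite -u2; lra.
apply/eqP; rewrite -subr_eq0 -normr_eq0 -/u; apply: contra_eqT su => u0.
have {}u0 : 0 < u by rewrite lt_def u0 normr_ge0.
by rewrite gt_eqF // sin_gt0_pi //; apply/andP; split; lra.
Qed.

Lemma arc_inj (R : realType) (a b x y : R) : proper_arc a b ->
  a < x < b -> a < y < b -> circle_pt x = circle_pt y -> x = y.
Proof.
move=> /andP[ab1 ab2] /andP[ax xb] /andP[ay yb]; apply: circle_pt_inj.
by rewrite ltr_norml; apply/andP; split; lra.
Qed.

Section arc_poset.
Variables (R : realType) (a b : R) (hab : proper_arc a b).

Definition arc_le (z w : circle R) : Prop :=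
  exists x y, [/\ a < x < b, a < y < b, z = circle_pt x, w = circle_pt y &
                  x <= y].

Let arc_le_carrier z w : arc_le z w -> circle_arc a b z /\ circle_arc a b w.
Proof.
move=> [x [y [ax ay -> -> _]]].
by split; [exists x|exists y]; rewrite //= in_itv.
Qed.

Let arc_le_refl z : circle_arc a b z -> arc_le z z.
Proof. by case=> x /=; rewrite in_itv /= => ax <-; exists x, x. Qed.

Let arc_le_anti z w : arc_le z w -> arc_le w z -> z = w.
Proof.
move=> [x [y [ax ay -> -> xy]]] [y' [x' [ay' ax' ey ex yx]]].
have ? := arc_inj hab ax ax' ex; have ? := arc_inj hab ay ay' ey.
by congr circle_pt; apply/eqP; rewrite eq_le xy /=; subst.
Qed.

Let arc_le_trans w z v : arc_le z w -> arc_le w v -> arc_le z v.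
Proof.
move=> [x [y [ax ay -> -> xy]]] [y' [t [ay' at_ ey -> yt]]].
exists x, t; split=> //; have yy' := arc_inj hab ay ay' ey.
by rewrite (le_trans xy) // yy'.
Qed.

Definition arc_poset : subposet (circle R) :=
  Subposet arc_le_carrier arc_le_refl arc_le_anti arc_le_trans.

End arc_poset.

Section discrete_poset.
Variables (X : Type) (A : set X).

Definition discrete_poset : subposet X.
Proof.
refine (@Subposet X A (fun p q => A p /\ p = q) _ _ _ _).
- by move=> p q [Ap <-].
- by [].
- by move=> p q [].
- by move=> q p r [Ap ->].
Defined.

End discrete_poset.

Definition circle_basis (R : realType) : set (subposet (circle R)) :=
  [set B | exists a b, proper_arc a b /\ B = discrete_poset (circle_arc a b)].
Arguments circle_basis R : clear implicits.

Section circle_topology.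
Variable R : realType.

Lemma continuous_ReIm : continuous (@complex.Re R : R[i]^o -> R) /\
  continuous (@complex.Im R : R[i]^o -> R).
Proof.
split=> z; have FF : Filter (nbhs (z : R[i]^o)) by [exact: nbhs_filter];
  apply/(@cvgrPdist_lt _ _ _ _ FF) => e e0;
  have E0 : 0 < (e%:C)%C :> R[i] by [rewrite ltcR];
  apply: filterS (nbhsx_ballx (z : R[i]^o) _ E0) => t;
  rewrite /ball /= -ltcR; apply: le_lt_trans.
  have -> : complex.Re z - complex.Re t = complex.Re ((z : R[i]) - t).
    by case: (z) (t) => [? ?] [].
  exact: normc_ge_Re.
have -> : complex.Im z - complex.Im t = complex.Im ((z : R[i]) - t).
  by case: (z) (t) => [? ?] [].
by rewrite normc_def lecR -sqrtr_sqr ler_wsqrtr // lerDr sqr_ge0.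
Qed.

Lemma continuous_expi : continuous (@expi R).
Proof.
move=> x; apply/cvgrPdist_lt => E E0.
have [e0 Ee] : 0 < complex.Re E /\ E = ((complex.Re E)%:C)%C.
  by case: E E0 => u v; rewrite ltcE /= => /andP[/eqP -> ->].
rewrite Ee; move: e0; set e := complex.Re E => e0.
have e20 : 0 < e / 2 by rewrite divr_gt0.
near=> t; rewrite normc_def ltcR /=.
have : `|cos x - cos t| < e / 2.
  by near: t; apply: (@cvgr_dist_lt _ R^o); [exact: continuous_cos|].
have : `|sin x - sin t| < e / 2.
  by near: t; apply: (@cvgr_dist_lt _ R^o); [exact: continuous_sin|].
move=> h1 h2.
have -> : e = Num.sqrt (e ^+ 2) by rewrite sqrtr_sqr gtr0_norm.
rewrite ltr_sqrt ?exprn_gt0 //.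
rewrite -[X in X ^+ 2 + _]/(cos x - cos t) -[X in _ + X ^+ 2]/(sin x - sin t).
rewrite -(real_normK (num_real (cos _ - _))).
rewrite -(real_normK (num_real (sin _ - _))).
suff H (u v : R) : 0 <= u -> 0 <= v -> u < e / 2 -> v < e / 2 ->
  u ^+ 2 + v ^+ 2 < e ^+ 2 by exact: H.
move=> u0 v0 ue ve; have ? : u ^+ 2 < (e / 2) ^+ 2 by rewrite ltr_sqr ?nnegrE// ltW.
have ? : v ^+ 2 < (e / 2) ^+ 2 by rewrite ltr_sqr ?nnegrE// ltW.
nra.
Unshelve. all: by end_near. Qed.

Lemma continuous_circle_pt : continuous (@circle_pt R).
Proof. exact/continuous_comp_initial/continuous_expi. Qed.

Lemma circle_ptE (m : R) (z : circle R) :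
  exists t, m - pi <= t <= m + pi /\ z = circle_pt t.
Proof.
case: z => -[x y] xyP; have := set_mem xyP; rewrite /circle /= normc_def /=.
move=> /complexI xy1; have {xy1} xy : x ^+ 2 + y ^+ 2 = 1.
  by rewrite -[LHS]sqr_sqrtr ?addr_ge0 ?sqr_ge0 // xy1 expr1n.
pose X := x * cos m + y * sin m; pose Y := y * cos m - x * sin m.
have XY : X ^+ 2 + Y ^+ 2 = 1.
  have -> : X ^+ 2 + Y ^+ 2 = (x ^+ 2 + y ^+ 2) * (cos m ^+ 2 + sin m ^+ 2).
    by rewrite /X /Y; ring.
  by rewrite cos2Dsin2 xy mulr1.
have X1 : -1 <= X <= 1 by apply/andP; split; nra.
have ge0 := acos_ge0 X1; have lepi := acos_lepi X1.
have cX : cos (acos X) = X by rewrite acosK // in_itv.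
have sX : sin (acos X) = `|Y|.
  by rewrite sin_acos // -sqrtr_sqr; congr Num.sqrt; lra.
have [s [sI cs ss]] : exists s, [/\ - pi <= s <= pi, cos s = X & sin s = Y].
  have [Y0|Y0] := leP 0 Y.
    exists (acos X); split=> //; last by rewrite sX ger0_norm.
    by apply/andP; split; lra.
  exists (- acos X); split; rewrite ?cosN ?sinN //.
    by apply/andP; split; lra.
  by rewrite sX ltr0_norm // opprK.
exists (m + s); split; first by apply/andP; split; lra.
apply: val_inj; rewrite /= /expi cosD sinD cs ss /X /Y; congr Complex.
  have -> : cos m * (x * cos m + y * sin m) - sin m * (y * cos m - x * sin m)
    = x * (cos m ^+ 2 + sin m ^+ 2) by ring.
  by rewrite cos2Dsin2 mulr1.
have -> : sin m * (x * cos m + y * sin m) + cos m * (y * cos m - x * sin m)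
  = y * (cos m ^+ 2 + sin m ^+ 2) by ring.
by rewrite cos2Dsin2 mulr1.
Qed.

Lemma open_circle_arc (a b : R) : proper_arc a b -> open (circle_arc a b).
Proof.
move=> /andP[ab1 ab2]; pose m := (a + b) / 2; pose w := (b - a) / 2.
pose f (z : R[i]^o) : R := complex.Re z * cos m + complex.Im z * sin m.
have cf : continuous f.
  have [cR cI] := continuous_ReIm.
  move=> z; have FF : Filter (nbhs (z : R[i]^o)) by exact: nbhs_filter.
  exact: (@cvgD _ R^o _ _ FF _ _ _ _
    (@cvgM _ _ _ FF _ _ _ _ (cR z) (cvg_cst (cos m)))
    (@cvgM _ _ _ FF _ _ _ _ (cI z) (cvg_cst (sin m)))).
suff -> : circle_arc a b = \val @^-1` (f @^-1` [set x | cos w < x]).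
  exists (f @^-1` [set x | cos w < x]) => //.
  by apply: open_comp => [z _|]; [exact: cf|exact: open_gt].
have w0 : w \in `[0, pi] by rewrite in_itv /= /w; apply/andP; split; lra.
have key t : m - pi <= t <= m + pi -> (cos w < f (expi t)) = (a < t < b).
  move=> /andP[t1 t2]; rewrite /f /= -cosB -[cos (t - m)]cos_norm.
  rewrite ltr_cos //; last first.
    by rewrite in_itv /= normr_ge0 ler_norml; apply/andP; split; lra.
  by rewrite ltr_norml /m /w; apply/idP/idP => /andP[? ?]; apply/andP; split; lra.
apply/seteqP; split=> [z [t /=]|z /= fz].
  rewrite in_itv /= => tab <-; rewrite /= key //.
  by move/andP: tab => [? ?]; rewrite /m; apply/andP; split; lra.
have [t [tI zt]] := circle_ptE m z; exists t => //=.
by rewrite in_itv /= -key //; move: fz; rewrite zt.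
Qed.

Lemma nbhs_arc (t : R) (U : set (circle R)) : nbhs (circle_pt t) U ->
  exists2 e, 0 < e & forall r, 0 < r < e -> circle_arc (t - r) (t + r) `<=` U.
Proof.
move=> zU; have /nbhs_ballP [e /= e0 eU] : nbhs t ((@circle_pt R) @^-1` U).
  exact: (@continuous_circle_pt t U zU).
exists e => // r /andP[r0 re] z [x /=]; rewrite in_itv /= => /andP[h1 h2] <-.
by apply: eU; rewrite /ball /= ltr_norml; apply/andP; split; lra.
Qed.

Lemma arcS (a b x t e : R) : a < x < b -> circle_pt x = circle_pt t ->
  0 < e -> e < x - a -> e < b - x ->
  forall y, t - e < y < t + e ->
    a < y + (x - t) < b /\ circle_pt y = circle_pt (y + (x - t)).
Proof.
move=> /andP[ax xb] xt e0 ea eb y /andP[ty yt]; split.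
  by apply/andP; split; lra.
have := circle_ptD (y - t) xt.
have -> : x + (y - t) = y + (x - t) by ring.
by have -> : t + (y - t) = y by ring.
Qed.

Lemma arc_le_str (a b x t e : R) (hab : proper_arc a b)
  (he : proper_arc (t - e) (t + e)) :
  a < x < b -> circle_pt x = circle_pt t ->
  0 < e -> e < x - a -> e < b - x ->
  sub_str (arc_poset he) (arc_poset hab).
Proof.
move=> axb xt e0 ea eb; have H := arcS axb xt e0 ea eb; split.
  move=> _ [y /= + <-]; rewrite in_itv /= => /H[? ->].
  by exists (y + (x - t)); rewrite //= in_itv.
move=> _ _ [y /= + <-] [y' /= + <-]; rewrite !in_itv /= => yI y'I.
have [h1 e1] := H _ yI; have [h2 e2] := H _ y'I.
split=> -[u [v [uI vI yu y'v uv]]].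
  have ? := arc_inj he yI uI yu; have ? := arc_inj he y'I vI y'v; subst u v.
  by exists (y + (x - t)), (y' + (x - t)); split=> //; rewrite lerD2r.
exists y, y'; split=> //.
have := arc_inj hab h1 uI (etrans (esym e1) yu).
have := arc_inj hab h2 vI (etrans (esym e2) y'v).
by move=> ? ?; lra.
Qed.

Lemma arc_small (a b a' b' : R) (hab : proper_arc a b) (hab' : proper_arc a' b')
    (z : circle R) (U : set (circle R)) :
  circle_arc a b z -> circle_arc a' b' z -> nbhs z U ->
  exists c d (hcd : proper_arc c d),
    [/\ circle_arc c d z, circle_arc c d `<=` U, sub_str (arc_poset hcd) (arc_poset hab) &
        sub_str (arc_poset hcd) (arc_poset hab')].
Proof.
case=> t /=; rewrite in_itv /= => tI <- [x /=]; rewrite in_itv /= => xI xt.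
move=> /nbhs_arc [e0 e00 He].
have [/andP[t1 t2] /andP[x1 x2]] := (tI, xI).
have p0 : 0 < pi :> R by exact: pi_gt0.
pose M := Num.min e0 (Num.min pi
  (Num.min (Num.min (t - a) (b - t)) (Num.min (x - a') (b' - x)))).
have M0 : 0 < M by rewrite /M !lt_min e00 p0 !subr_gt0 t1 t2 x1 x2.
have Mle : [/\ M <= e0, M <= pi, M <= t - a, M <= b - t & M <= x - a' /\ M <= b' - x].
  have := lexx M; rewrite {2}/M !le_min.
  by move=> /andP[-> /andP[-> /andP[/andP[-> ->] /andP[-> ->]]]].
case: Mle => m1 m2 m3 m4 [m5 m6].
have he : proper_arc (t - M / 2) (t + M / 2) by apply/andP; split; lra.
exists (t - M / 2), (t + M / 2), he; split.
- by exists t => //=; rewrite in_itv /=; apply/andP; split; lra.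
- by apply: He; apply/andP; split; lra.
- by apply: (@arc_le_str _ _ t) => //; lra.
- by apply: (@arc_le_str _ _ x) => //; lra.
Qed.

Lemma proper_pi2 (t : R) : proper_arc (t - pi / 2) (t + pi / 2).
Proof. by have := @pi_gt0 R; move=> ?; apply/andP; split; lra. Qed.

Lemma arc_at (z : circle R) : exists a b, proper_arc a b /\ circle_arc a b z.
Proof.
have [t [_ ->]] := circle_ptE 0 z; exists (t - pi / 2), (t + pi / 2).
split; first exact: proper_pi2.
by have := @pi_gt0 R => ?; exists t => //=; rewrite in_itv /=; apply/andP; split; lra.
Qed.

Lemma circle_basisP : strict_ordered_basis (circle_basis R).
Proof.
suff [H1 H2] : basis [set carrier B | B in circle_basis R] /\
   forall x B B', circle_basis R B -> circle_basis R B' ->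
    carrier B x -> carrier B' x -> exists B'', [/\ circle_basis R B'',
      carrier B'' x, sub_str B'' B & sub_str B'' B'].
  split=> //; split=> // x B B' h1 h2 h3 h4.
  have [B'' [? ? ? ?]] := H2 x B B' h1 h2 h3 h4.
  by exists B''; split=> //; exact: sub_str_lax.
split; first split.
- by move=> _ [_ [a [b [hab ->]]] <-]; exact: open_circle_arc.
- move=> z U zU; have [a [b [hab abz]]] := arc_at z.
  have [c [d [hcd [cdz cdU _ _]]]] := arc_small hab hab abz abz zU.
  exists (circle_arc c d) => //; split=> //.
  by exists (discrete_poset (circle_arc c d)) => //; exists c, d.
- move=> z _ _ [a [b [hab ->]]] [a' [b' [hab' ->]]] /= abz abz'.
  have [c [d [hcd [cdz _ [h1 _] [h2 _]]]]] :=
    arc_small hab hab' abz abz' filterT.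
  exists (discrete_poset (circle_arc c d)); split=> //; first by exists c, d.
    by split=> //= p q cp cq; split=> -[_ <-]; split=> //; exact: h1.
  by split=> //= p q cp cq; split=> -[_ <-]; split=> //; exact: h2.
Qed.

End circle_topology.

Definition circle_lo (R : realType) : lospace :=
  lospace_of (circle_basisP R).1.

Definition unit_itv (R : realType) : set R := `[0, 1].
Arguments unit_itv R : clear implicits.

(* I(n) for n in N u {+oo}; [None] stands for +oo.                              *)
Definition stripe (R : realType) (d : nat -> R) (n : option nat) : set R :=
  if n is Some k then `[d k.*2.+1, d k.*2] else [set 0].

Section zebra.
Variables (R : realType) (d : nat -> R).
Local Notation I := (set_type (unit_itv R)).

Section zebra_poset.
Variables (a b : R) (hab : proper_arc a b) (O : set I).

Definition zebra_le (p q : circle R * I) : Prop :=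
  [/\ (circle_arc a b `*` O) p, (circle_arc a b `*` O) q &
   (sle (arc_poset hab) p.1 q.1 /\ p.2 = q.2 /\
     exists n, stripe d n (\val p.2)) \/
   (p.1 = q.1 /\ p.2 = q.2)].

Let zebra_le_carrier p q :
  zebra_le p q -> (circle_arc a b `*` O) p /\ (circle_arc a b `*` O) q.
Proof. by case. Qed.

Let zebra_le_refl p : (circle_arc a b `*` O) p -> zebra_le p p.
Proof. by move=> h; split=> //; right. Qed.

Let zebra_le_anti p q : zebra_le p q -> zebra_le q p -> p = q.
Proof.
case: p q => [s u] [s' u'] [_ _ /= h1] [_ _ /= h2].
case: h1 h2 => [[l1 [-> _]]|[-> ->] //] [[l2 _]|[-> _] //].
by rewrite (@sle_anti _ (arc_poset hab) _ _ l1 l2).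
Qed.

Let zebra_le_trans q p r : zebra_le p q -> zebra_le q r -> zebra_le p r.
Proof.
case: p q r => [s u] [s' u'] [s'' u''] [hp _ /= h1] [_ hr /= h2].
split=> //=; case: h1 h2 => [[l1 [-> st]]|[-> ->]] [[l2 [-> st']]|[<- <-]];
  [left|left|left|by right]; split=> //.
exact: (@sle_trans _ (arc_poset hab) _ _ _ l1 l2).
Qed.

Definition zebra_poset : subposet (circle R * I)%type :=
  Subposet zebra_le_carrier zebra_le_refl zebra_le_anti zebra_le_trans.

End zebra_poset.

Definition zebra_basis : set (subposet (circle R * I)%type) :=
  [set B | exists a b (hab : proper_arc a b) (O : set I),
             open O /\ B = zebra_poset hab O].

Lemma zebra_basisP : strict_ordered_basis zebra_basis.
Proof.
suff [H1 H2] : basis [set carrier B | B in zebra_basis] /\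
   forall x B B', zebra_basis B -> zebra_basis B' ->
    carrier B x -> carrier B' x -> exists B'', [/\ zebra_basis B'',
      carrier B'' x, sub_str B'' B & sub_str B'' B'].
  split=> //; split=> // x B B' h1 h2 h3 h4.
  have [B'' [? ? ? ?]] := H2 x B B' h1 h2 h3 h4.
  by exists B''; split=> //; exact: sub_str_lax.
have str a b (hab : proper_arc a b) c e (hce : proper_arc c e) (O O' : set I) :
    sub_str (arc_poset hce) (arc_poset hab) -> O' `<=` O ->
    sub_str (zebra_poset hce O') (zebra_poset hab O).
  move=> [s1 s2] O'O; split=> [[s u] [/s1 ? /O'O //]|].
  move=> [s u] [s' u'] [cs Ou] [cs' Ou'].
  split=> -[_ _ h]; split; rewrite /setX //=.
  - by split; [exact: s1|exact: O'O].
  - by split; [exact: s1|exact: O'O].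
  - by case: h => [[l h]|h]; [left; split=> //; exact/(s2 s s')|right].
  - by case: h => [[l h]|h]; [left; split=> //; exact/(s2 s s')|right].
split; first split.
- move=> _ [_ [a [b [hab [ O [ oO ->]]]]] <-] /=.
  by rewrite openE => -[s u] [sA uO]; exists (circle_arc a b, O) => //=; split;
    apply: open_nbhs_nbhs; split=> //; exact: open_circle_arc.
- move=> [s u] U [[V W] [sV uW] VWU].
  have [a [b [hab abs]]] := arc_at s.
  have [c [e [hce [ces ceV _ _]]]] := arc_small hab hab abs abs sV.
  exists (circle_arc c e `*` (W°)).
    split; last by split.
    exists (zebra_poset hce (W°)) => //; exists c, e, hce, (W°); split=> //.
    exact: open_interior.
  by move=> [s' u'] [/ceV ? /interior_subset ?]; exact: VWU.
- move=> [s u] _ _ [a [b [hab [ O [ oO ->]]]]] [a' [b' [hab' [ O' [ oO' ->]]]]].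
  move=> [abs Ou] [abs' O'u].
  have [c [e [hce [ces _ h1 h2]]]] := arc_small hab hab' abs abs' filterT.
  exists (zebra_poset hce (O `&` O')); split=> //=.
  + by exists c, e, hce, (O `&` O'); split=> //; exact: openI.
  + by apply: str => // ? [].
  + by apply: str => // ? [].
Qed.

Definition zebra : lospace := lospace_of zebra_basisP.1.

Lemma unit_itv0 : (0 : R) \in unit_itv R.
Proof. by apply: mem_set; rewrite /unit_itv /= in_itv /= lexx ler01. Qed.

Definition itv0 : I := exist _ (0 : R) unit_itv0.

Lemma zebra_i0_subproof (x : circle_lo R) :
  @locally_increasing_at (circle_lo R) zebra (fun s => (s, itv0)) x.
Proof.
apply/(locally_increasing_atE _ _
  (lo_bases_of (circle_basisP R).1) (lo_bases_of zebra_basisP.1)).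
move=> _ [a [b [hab [ O [ oO ->]]]]] [abx O0].
exists (discrete_poset (circle_arc a b)); split=> //=; first by exists a, b.
  by move=> _ [s abs <-].
by move=> p _ [abp <-]; split=> //; right.
Qed.

Lemma zebra_c0_subproof (x : circle_lo R) :
  @locally_increasing_at (circle_lo R) zebra (fun=> (circle_pt 0, itv0)) x.
Proof.
apply/(locally_increasing_atE _ _
  (lo_bases_of (circle_basisP R).1) (lo_bases_of zebra_basisP.1)).
move=> _ [a' [b' [hab' [ O [ oO ->]]]]] [abx O0].
have [a [b [hab abx']]] := arc_at x.
exists (discrete_poset (circle_arc a b)); split=> //=; first by exists a, b.
  by move=> _ [s abs <-].
by move=> p q _; split=> //; right.
Qed.

Definition zebra_i0 : lomorphism (circle_lo R) zebra :=
  Lomorphism zebra_i0_subproof.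

Definition zebra_c0 : lomorphism (circle_lo R) zebra :=
  Lomorphism zebra_c0_subproof.

End zebra.

Section objects.
Variable R : realType.

Lemma cvg_closed_eq (T : topologicalType) (f g : T -> R) :
  continuous f -> continuous g -> closed [set x | f x = g x].
Proof.
move=> cf cg; have -> : [set x | f x = g x] = (f \- g) @^-1` [set 0].
  apply/seteqP; split=> x /=; first by move->; rewrite subrr.
  by move/eqP; rewrite subr_eq0 => /eqP.
apply: preimage_closed => [x _|]; last exact: closed_eq.
exact: (@cvgB _ R^o _ _ _ _ _ _ _ (cf x) (cg x)).
Qed.

Lemma cvg_closed_le0 (T : topologicalType) (f : T -> R) :
  continuous f -> closed [set x | f x <= 0].
Proof.
move=> cf; have := @preimage_closed T R f [set y | y <= 0].
by apply=> [x _|]; [exact: cf|exact: closed_le].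
Qed.

Lemma separated_hausdorff (T : topologicalType) :
  (forall x y : T, (forall f : T -> R, continuous f -> f x = f y) -> x = y) ->
  hausdorff_space T.
Proof.
move=> sep p q pq; apply: sep => f cf; apply: (@Rhausdorff R) => A B fA fB.
by have [x [Ax Bx]] := pq _ _ (cf p _ fA) (cf q _ fB); exists (f x).
Qed.

Lemma nachbin_closed (X : topologicalType) (A : subposet X) (F : set (X * X)) :
  closed F ->
  (forall p q, carrier A p -> carrier A q -> sle A p q <-> F (p, q)) ->
  nachbin_subposet A.
Proof.
move=> cF AF; split=> [[p pA]|[p pA] [q qA] pq qp|q p r|] /=.
- exact/sle_refl/set_mem.
- exact/val_inj/(sle_anti pq qp).
- exact: sle_trans.
pose f (z : set_type (carrier A) * set_type (carrier A)) : X * X :=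
  (\val z.1, \val z.2).
have -> : [set z | sle A (\val z.1) (\val z.2)] = f @^-1` F.
  by apply/seteqP; split=> -[[p pA] [q qA]] /= /AF; apply; exact: set_mem.
apply: preimage_closed => // z _.
have cv : continuous (\val : set_type (carrier A) -> X).
  exact: initial_continuous.
exact: (cvg_pair
  (@continuous_comp _ _ _ fst (\val : set_type (carrier A) -> X) z
     cvg_fst (cv _))
  (@continuous_comp _ _ _ snd (\val : set_type (carrier A) -> X) z
     cvg_snd (cv _))).
Qed.

Lemma locally_nachbin_basis (X : lospace) (BB : set (subposet X)) :
  lo_bases BB -> (forall B, BB B -> nachbin_subposet B) -> locally_nachbin X.
Proof.
move=> hBB nB x O /(_ _ hBB) oO /oO [B [BB_B Bx BO]].
exists B; split=> //; last exact: nB.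
by move=> BB' hBB' y By; exact: (lo_bases_coarser hBB hBB' BB_B By).
Qed.

Definition circle_re (s : circle R) : R := complex.Re (\val s).
Definition circle_im (s : circle R) : R := complex.Im (\val s).

Lemma continuous_circle_val : continuous (\val : circle R -> R[i]^o).
Proof. exact: initial_continuous. Qed.

Lemma continuous_circle_re : continuous circle_re.
Proof.
move=> s; exact: (@continuous_comp (circle R) R[i]^o R \val (@complex.Re R) s
  (@continuous_circle_val s) ((continuous_ReIm R).1 _)).
Qed.

Lemma continuous_circle_im : continuous circle_im.
Proof.
move=> s; exact: (@continuous_comp (circle R) R[i]^o R \val (@complex.Im R) s
  (@continuous_circle_val s) ((continuous_ReIm R).2 _)).
Qed.

Lemma circle_inj (s t : circle R) :
  circle_re s = circle_re t -> circle_im s = circle_im t -> s = t.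
Proof.
move=> re im; apply: val_inj; move: re im; rewrite /circle_re /circle_im.
by case: (\val s) (\val t) => [? ?] [? ?] /= -> ->.
Qed.

Lemma hausdorff_circle : hausdorff_space (circle R).
Proof.
apply: separated_hausdorff => s t st; apply: circle_inj.
  exact/st/continuous_circle_re.
exact/st/continuous_circle_im.
Qed.

Lemma circle_category (strict nachbin hausdorff : bool) :
  lo_category strict nachbin hausdorff (circle_lo R).
Proof.
split=> _; last exact: hausdorff_circle.
  exists (circle_basis R); last exact: circle_basisP.
  exact: (lo_bases_of (circle_basisP R).1).
apply: (locally_nachbin_basis (lo_bases_of (circle_basisP R).1)).
move=> _ [a [b [hab ->]]].
pose F := [set z : circle R * circle R | circle_re z.1 = circle_re z.2] `&`
          [set z | circle_im z.1 = circle_im z.2].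
apply: (@nachbin_closed _ _ F).
  by apply: closedI; apply: cvg_closed_eq => z; apply: continuous_comp;
    by [exact: cvg_fst|exact: cvg_snd|exact: continuous_circle_re|
        exact: continuous_circle_im].
move=> p q pA qA /=; split=> [[_ <-]//|[/= h1 h2]]; split=> //.
exact: circle_inj.
Qed.

Section arc_closed.
Variables a b : R.
Let m := (a + b) / 2.
Let X s := circle_re s * cos m + circle_im s * sin m.
Let Y s := circle_im s * cos m - circle_re s * sin m.

(* sin x + sin (x - y) - sin y for the angles x, y of s, t relative to the     *)
(* midpoint of the arc; its sign is that of x - y.                              *)
Definition arc_cmp (s t : circle R) : R := Y s * (1 + X t) - Y t * (1 + X s).

Lemma arc_leE (s t : circle R) : proper_arc a b -> circle_arc a b s -> circle_arc a b t ->
  arc_le a b s t <-> arc_cmp s t <= 0.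
Proof.
move=> hab [x /= + <-] [y /= + <-]; rewrite !in_itv /= => xI yI.
have -> : arc_le a b (circle_pt x) (circle_pt y) <-> x <= y.
  split=> [[x' [y' [x'I y'I ex ey xy']]]|xy]; last by exists x, y.
  by rewrite (arc_inj hab xI x'I ex) (arc_inj hab yI y'I ey).
move: (hab) (xI) (yI) => /andP[_ ab2] /andP[ax xb] /andP[ay yb].
pose u := (x - m) / 2; pose v := (y - m) / 2.
have -> : arc_cmp (circle_pt x) (circle_pt y) =
    4 * cos u * cos v * sin (u - v).
  rewrite /arc_cmp /X /Y /circle_re /circle_im /=.
  have -> : cos x * cos m + sin x * sin m = cos (x - m) by rewrite cosB.
  have -> : cos y * cos m + sin y * sin m = cos (y - m) by rewrite cosB.
  have -> : sin x * cos m - cos x * sin m = sin (x - m) by rewrite sinB.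
  have -> : sin y * cos m - cos y * sin m = sin (y - m) by rewrite sinB.
  have -> : x - m = u *+ 2 by rewrite -mulr_natr mulfVK.
  have -> : y - m = v *+ 2 by rewrite -mulr_natr mulfVK.
  rewrite !sin_mulr2n !cos_mulr2n sinB; ring.
have cu : 0 < cos u by apply: cos_gt0_pihalf; rewrite /u /m; apply/andP; split; lra.
have cv : 0 < cos v by apply: cos_gt0_pihalf; rewrite /v /m; apply/andP; split; lra.
rewrite pmulr_rle0 ?mulr_gt0 // ?ltr0n //; split=> [xy|].
  rewrite -oppr_ge0 -sinN opprB; apply: sin_ge0_pi; rewrite /u /v /m.
  by apply/andP; split; lra.
apply: contraTT; rewrite -!ltNge => yx; apply: sin_gt0_pi; rewrite /u /v /m.
by apply/andP; split; lra.
Qed.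

Lemma closed_arc_cmp (T : topologicalType) (f g : T -> circle R) :
  continuous f -> continuous g -> closed [set x | arc_cmp (f x) (g x) <= 0].
Proof.
move=> cf cg; apply: cvg_closed_le0 => z.
have cM (p q : T -> R) : {for z, continuous p} -> {for z, continuous q} ->
  {for z, continuous (p \* q)} by move=> *; exact: cvgM.
have cD (p q : T -> R) : {for z, continuous p} -> {for z, continuous q} ->
  {for z, continuous (p \+ q)} by move=> ? ?; exact: (@cvgD _ R^o).
have cB (p q : T -> R) : {for z, continuous p} -> {for z, continuous q} ->
  {for z, continuous (p \- q)} by move=> ? ?; exact: (@cvgB _ R^o).
have cc (k : R) : {for z, continuous (fun _ : T => k)} by exact: cvg_cst.
have cre h : continuous h -> {for z, continuous (circle_re \o h)}.
  by move=> ch; exact: (@continuous_comp _ _ _ h circle_re z (ch z)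
    (@continuous_circle_re _)).
have cim h : continuous h -> {for z, continuous (circle_im \o h)}.
  by move=> ch; exact: (@continuous_comp _ _ _ h circle_im z (ch z)
    (@continuous_circle_im _)).
have cX h : continuous h -> {for z, continuous (X \o h)}.
  by move=> ch; exact: (cD _ _ (cM _ _ (cre h ch) (cc _)) (cM _ _ (cim h ch) (cc _))).
have cY h : continuous h -> {for z, continuous (Y \o h)}.
  by move=> ch; exact: (cB _ _ (cM _ _ (cim h ch) (cc _)) (cM _ _ (cre h ch) (cc _))).
exact: (cB _ _ (cM _ _ (cY f cf) (cD _ _ (cc 1) (cX g cg)))
               (cM _ _ (cY g cg) (cD _ _ (cc 1) (cX f cf)))).
Qed.

End arc_closed.

Section zebra_object.
Variable d : nat -> R.
Hypotheses (d_itv : forall n : nat, 0 <= d n <= 1) (d_decr : decreasing_seq d)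
  (d_inf : inf (range d) = 0).

Lemma closed_stripes : closed [set x | exists n, stripe d n x].
Proof.
have d0 n : 0 <= d n by have /andP[] := d_itv n.
have dle n p : (d n <= d p) = (p <= n)%N by exact: d_decr.
have dlt n p : (d n < d p) = (p < n)%N by rewrite ltNge dle -ltnNge.
have stripe_ge0 n x : stripe d n x -> 0 <= x.
  case: n => [n|->//] /=; rewrite in_itv /= => /andP[+ _].
  exact: le_trans (d0 _).
have stripe_le n x : stripe d n x -> x <= d 0.
  case: n => [n|->//] /=; rewrite in_itv /= => /andP[_] /le_trans; apply.
  by rewrite dle.
rewrite -openC openE => x /= xS; rewrite /interior.
have nb (U : set R) : open U -> U x ->
    (forall y, U y -> ~ exists n, stripe d n y) ->
    nbhs x (~` [set x | exists n, stripe d n x]).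
  by move=> oU Ux US; apply: (filterS (P := U)) => //; exact: open_nbhs_nbhs.
have [x0|x0] := ltP x 0.
  apply: (nb [set y | y < 0]) => //.
  by move=> y /= y0 [n /stripe_ge0]; rewrite leNgt y0.
have [xd|xd] := ltP (d 0) x.
  apply: (nb [set y | d 0 < y]) => //.
  by move=> y /= yd [n /stripe_le]; rewrite leNgt yd.
have {}x0 : 0 < x.
  by rewrite lt_def x0 andbT; apply: contra_notN xS => /eqP ->; exists None.
have dx : exists n, d n < x.
  have dinf : has_inf (range d).
    by split; [exists (d 0), 0%N|exists 0 => _ [n _ <-]].
  have [_ [n _ <-]] := inf_adherent x0 dinf.
  by rewrite d_inf add0r; exists n.
have [n dn nmin] := find_ex_minn dx.
case: n => [|n] in dn nmin *; first by move: dn; rewrite ltNge xd.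
have xn : x <= d n by rewrite leNgt; apply/negP => /nmin; rewrite ltnn.
have [[k nk]|[k nk]] : (exists k, n = k.*2) \/ (exists k, n = k.*2.+1).
- have := odd_double_half n; case: (odd n) => <-; first by right; exists n./2.
  by left; exists n./2.
- exfalso; apply: xS; exists (Some k) => /=.
  by rewrite in_itv /= -nk xn ltW.
have {}xn : x < d n.
  rewrite lt_neqAle xn andbT; apply: contra_notN xS => /eqP ->.
  by exists (Some k); rewrite /= in_itv /= nk lexx dle leqnSn.
apply: (nb [set` `]d n.+1, d n[%R]); first exact: interval_open.
  by rewrite /= in_itv /= dn xn.
move=> y /=; rewrite in_itv /= => /andP[y1 y2] [[j|]] /=; last first.
  by move=> y0; move: y1; rewrite y0 ltNge d0.
rewrite in_itv /= => /andP[y3 y4].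
have := le_lt_trans y3 y2; have := lt_le_trans y1 y4.
by rewrite !dlt nk; lia.
Qed.

Definition zebra_closed (a b : R) :
    set ((circle R * set_type (unit_itv R)) * (circle R * set_type (unit_itv R))) :=
  [set z | \val z.1.2 = \val z.2.2] `&`
  (([set z | arc_cmp a b z.1.1 z.2.1 <= 0] `&`
    [set z | exists n, stripe d n (\val z.1.2)]) `|`
   ([set z | circle_re z.1.1 = circle_re z.2.1] `&`
    [set z | circle_im z.1.1 = circle_im z.2.1])).

Lemma zebra_category (strict nachbin hausdorff : bool) :
  lo_category strict nachbin hausdorff (zebra d).
Proof.
pose I := set_type (unit_itv R).
have cI : continuous (\val : I -> R) by exact: initial_continuous.
have comp (T U V : topologicalType) (f : T -> U) (g : U -> V) :
    continuous f -> continuous g -> continuous (g \o f).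
  by move=> cf cg x; apply: continuous_comp; [exact: cf|exact: cg].
have c1 (T U : topologicalType) : continuous (@fst T U) by move=> z; exact: cvg_fst.
have c2 (T U : topologicalType) : continuous (@snd T U) by move=> z; exact: cvg_snd.
split=> _.
- exists (zebra_basis d); last exact: zebra_basisP.
  exact: (lo_bases_of (zebra_basisP d).1).
- apply: (locally_nachbin_basis (lo_bases_of (zebra_basisP d).1)).
  move=> _ [a [b [hab [ O [ oO ->]]]]].
  apply: (@nachbin_closed _ _ (zebra_closed a b)).
    have cs1 : continuous (fun z : (circle R * I) * (circle R * I) => z.1.1).
      exact: (comp _ _ _ _ _ (c1 _ _) (c1 _ _)).
    have cs2 : continuous (fun z : (circle R * I) * (circle R * I) => z.2.1).
      exact: (comp _ _ _ _ _ (c2 _ _) (c1 _ _)).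
    have cu1 : continuous (fun z : (circle R * I) * (circle R * I) => \val z.1.2 : R).
      exact: (comp _ _ _ _ _ (comp _ _ _ _ _ (c1 _ _) (c2 _ _)) cI).
    have cu2 : continuous (fun z : (circle R * I) * (circle R * I) => \val z.2.2 : R).
      exact: (comp _ _ _ _ _ (comp _ _ _ _ _ (c2 _ _) (c2 _ _)) cI).
    apply: closedI; first exact: cvg_closed_eq.
    apply: closedU; apply: closedI.
    + exact: closed_arc_cmp.
    + apply: (@preimage_closed _ _ _ [set x : R | exists n, stripe d n x]).
        by move=> z _; exact: cu1.
      exact: closed_stripes.
    + by apply: cvg_closed_eq; [exact: (comp _ _ _ _ _ cs1 continuous_circle_re)
                               |exact: (comp _ _ _ _ _ cs2 continuous_circle_re)].
    + by apply: cvg_closed_eq; [exact: (comp _ _ _ _ _ cs1 continuous_circle_im)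
                               |exact: (comp _ _ _ _ _ cs2 continuous_circle_im)].
  move=> [s u] [t v] sO tO; have [/= sa uO] := sO; have [/= ta vO] := tO.
  split.
    move=> [_ _ /= [[st [<- un]]|[<- <-]]]; split=> //; last by right.
    by left; split=> //; exact/(arc_leE hab).
  move=> [/= uv [[st un]|[re im]]]; have {}uv : u = v by exact: val_inj.
    by split=> //; left; split=> //=; exact/(arc_leE hab).
  by split=> //; right; split=> //=; exact: circle_inj.
- apply: separated_hausdorff => -[s u] [t v] st.
  have -> : u = v.
    by apply: val_inj; exact: (st _ (comp _ _ _ _ _ (c2 _ _) cI)).
  congr pair; apply: circle_inj.
    exact: (st _ (comp _ _ _ _ _ (c1 _ _) continuous_circle_re)).
  exact: (st _ (comp _ _ _ _ _ (c1 _ _) continuous_circle_im)).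
Qed.
End zebra_object.
End objects.

(* Main.v *)
Require Import Defs.
From mathcomp Require Import all_boot all_order all_algebra.
From mathcomp Require Import all_classical all_reals all_analysis.
From mathcomp Require Import complex ring lra zify.
Set Implicit Arguments.
Unset Strict Implicit.
Unset Printing Implicit Defensive.
Import Order.TTheory GRing.Theory Num.Theory numFieldNormedType.Exports.
Local Open Scope classical_set_scope.
Local Open Scope ring_scope.

(** The reason is that a map out of the zebra cylinder which collapses the
    bottom circle must collapse every sufficiently low stripe, while any single
    stripe can escape being collapsed.

    Let [q] be a morphism to a locally ordered space that maps the circle at
    height 0 to one point, and let [B] be an ordered neighbourhood of that
    point. The bottom circle being compact, [q] is increasing from short arcs
    at height [u] to the single poset [B], for all heights [u] below some
    [e > 0]. When [u] lies in a stripe the arcs are ordered, so that going once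
    around the circle at height [u] produces an increasing loop in a poset,
    which is constant ([stripes_collapse]).

    Conversely, for each [n] there is a morphism that collapses the bottom
    circle but not the circles of the stripe [I(n)]. Its target is the plane in
    which only the unit circle carries a nontrivial local order, the
    counterclockwise one ([ccw_plane]); this space is strictly locally ordered,
    locally Nachbin and Hausdorff, so that it lies in each of the eight
    categories ([ccw_plane_category]). The morphism is [(s, u) |-> phi u * s]
    with [phi] continuous, equal to 0 below the gap that separates [I(n + 1)]
    from [I(n)] and to 1 above it ([cone_morphism]): it is locally increasing
    because a stripe is sent either to the origin or to the unit circle.

    A coequalizer [q] would collapse the lower edge of [I(n)] for [n] large,
    although the map just described, which does not, must factor through it. *)

(** * The plane with counterclockwise unit circle *)

Lemma continuous_compT (T U V : topologicalType) (f : T -> U) (g : U -> V) :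
  continuous f -> continuous g -> continuous (g \o f).
Proof. by move=> cf cg x; apply: continuous_comp; [exact: cf|exact: cg]. Qed.

Lemma continuous_fst {T U : topologicalType} : continuous (@fst T U).
Proof. by move=> z; exact: cvg_fst. Qed.

Lemma continuous_snd {T U : topologicalType} : continuous (@snd T U).
Proof. by move=> z; exact: cvg_snd. Qed.

Section ccw_plane.
Variable R : realType.
Local Notation plane := (R * R)%type.
Implicit Types (p q r : plane) (U V : set plane).

Definition sqnorm p : R := p.1 ^+ 2 + p.2 ^+ 2.
Definition dot p q : R := p.1 * q.1 + p.2 * q.2.
Definition cross p q : R := p.1 * q.2 - p.2 * q.1.

(** The local order is the restriction of this one global relation to open sets
    so small that it is an order there. Two such sets then carry the same order
    on their intersection, which makes them a strict ordered basis. On unit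
    vectors the sign of the cross product compares arguments, as long as these
    differ by less than [pi]. *)
Definition ccw p q : Prop :=
  p = q \/ [/\ sqnorm p = 1, sqnorm q = 1 & 0 <= cross p q].

Definition ccw_order U : Prop :=
  (forall p q, U p -> U q -> ccw p q -> ccw q p -> p = q) /\
  (forall q p r, U p -> U q -> U r -> ccw p q -> ccw q r -> ccw p r).

Lemma ccw_orderS U V : U `<=` V -> ccw_order V -> ccw_order U.
Proof.
move=> UV [anti trans]; split=> [p q Up Uq|q p r Up Uq Ur].
  by apply: anti; exact: UV.
by apply: trans; exact: UV.
Qed.

Lemma ccw_order_disc : ccw_order [set p | sqnorm p < 1].
Proof.
have ccwE p q : sqnorm p < 1 -> ccw p q -> p = q.
  by move=> p1 [//|[p1']]; move: p1; rewrite p1' ltxx.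
split=> [p q /= p1 _ /ccwE -> //|q p r /= p1 q1 _ /ccwE -> // /ccwE -> //].
Qed.

(** Transitivity comes from the identity
    [cross p r * dot v q = cross p q * dot v r + cross q r * dot v p], in which
    the products with [v] are positive. For antisymmetry, a vanishing cross
    product makes [p] and [q] proportional, with a positive factor since they
    lie in the same open half-plane, hence equal since they have norm 1. *)
Lemma ccw_order_halfplane v : ccw_order [set p | 0 < dot v p].
Proof.
split=> [[p1 p2] [q1 q2]|[q1 q2] [p1 p2] [r1 r2]] /=;
  case: v => v1 v2; rewrite /ccw /sqnorm /dot /cross /=.
  move=> vp vq [//|[np nq pq]] [//|[_ _ qp]].
  have {pq qp} pq : p1 * q2 = p2 * q1 by lra.
  set a := v1 * p1 + v2 * p2 in vp; set b := v1 * q1 + v2 * q2 in vq.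
  have e1 : p1 * b = q1 * a.
    have : p1 * b - q1 * a = v2 * (p1 * q2 - p2 * q1) by rewrite /a /b; ring.
    by rewrite pq subrr mulr0 => /eqP; rewrite subr_eq0 => /eqP.
  have e2 : p2 * b = q2 * a.
    have : p2 * b - q2 * a = v1 * (p2 * q1 - p1 * q2) by rewrite /a /b; ring.
    by rewrite pq subrr mulr0 => /eqP; rewrite subr_eq0 => /eqP.
  have ab2 : a ^+ 2 = b ^+ 2.
    have : (p1 * b) ^+ 2 + (p2 * b) ^+ 2 = (q1 * a) ^+ 2 + (q2 * a) ^+ 2.
      by rewrite e1 e2.
    by rewrite !exprMn -!mulrDl np nq !mul1r.
  have ab : a = b.
    by apply/eqP; rewrite -(@eqrXn2 _ 2) ?ltW // ab2.
  have b0 : b != 0 by rewrite gt_eqF.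
  by move: e1 e2; rewrite ab => /(mulIf b0) -> /(mulIf b0) ->.
move=> vp vq vr [[-> ->] //|[np nq pq]] [[<- <-]|[_ nr qr]]; first by right.
right; split=> //; set x := _ - _.
have : 0 <= x * (v1 * q1 + v2 * q2).
  have -> : x * (v1 * q1 + v2 * q2) = (p1 * q2 - p2 * q1) * (v1 * r1 + v2 * r2)
    + (q1 * r2 - q2 * r1) * (v1 * p1 + v2 * p2) by rewrite /x; ring.
  by rewrite addr_ge0 // mulr_ge0 // ltW.
by rewrite pmulr_lge0.
Qed.

Section ccw_poset.
Variables (U : set plane) (hU : ccw_order U).

Definition ccw_le p q : Prop := [/\ U p, U q & ccw p q].

Let ccw_le_carrier p q : ccw_le p q -> U p /\ U q.
Proof. by case. Qed.

Let ccw_le_refl p : U p -> ccw_le p p.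
Proof. by move=> Up; split=> //; left. Qed.

Let ccw_le_anti p q : ccw_le p q -> ccw_le q p -> p = q.
Proof. by move=> [Up Uq pq] [_ _ qp]; exact: hU.1 pq qp. Qed.

Let ccw_le_trans q p r : ccw_le p q -> ccw_le q r -> ccw_le p r.
Proof. by move=> [Up Uq pq] [_ Ur qr]; split=> //; exact: hU.2 pq qr. Qed.

Definition ccw_poset : subposet plane :=
  Subposet ccw_le_carrier ccw_le_refl ccw_le_anti ccw_le_trans.

End ccw_poset.

Lemma ccw_poset_str U V (hU : ccw_order U) (hV : ccw_order V) :
  U `<=` V -> sub_str (ccw_poset hU) (ccw_poset hV).
Proof.
move=> UV; split=> //= p q Up Uq.
by split=> -[_ _ pq]; split=> //; exact: UV.
Qed.

Definition ccw_basis : set (subposet plane) :=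
  [set B | exists U (hU : ccw_order U), open U /\ B = ccw_poset hU].

Lemma continuous_dot v : continuous (dot v).
Proof.
move=> p; apply: (@cvgD _ R^o); apply: (@cvgM R);
  by [exact: cvg_cst|exact: cvg_fst|exact: cvg_snd].
Qed.

Lemma continuous_sqnorm : continuous sqnorm.
Proof.
move=> p; rewrite /continuous_at /sqnorm.
under eq_fun do rewrite !expr2; rewrite !expr2.
by apply: (@cvgD _ R^o); apply: (@cvgM R); by [exact: cvg_fst|exact: cvg_snd].
Qed.

(** The open disc contains no point of the unit circle, so that the relation is
    equality there; any other point is nonzero and lies in the half-plane to
    which it is the inner normal. *)
Lemma ccw_order_locally p : exists U, [/\ ccw_order U, open U & U p].
Proof.
have [p1|p1] := ltP (sqnorm p) 1.
  exists [set p | sqnorm p < 1]; split=> //; first exact: ccw_order_disc.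
  apply: (@open_comp _ _ sqnorm [set x | x < 1]); last exact: open_lt.
  by move=> ? _; exact: continuous_sqnorm.
exists [set q | 0 < dot p q]; split; first exact: ccw_order_halfplane.
  apply: (@open_comp _ _ (dot p) [set x | 0 < x]); last exact: open_gt.
  by move=> ? _; exact: continuous_dot.
by rewrite /= /dot -!expr2; exact: lt_le_trans p1.
Qed.

Lemma ccw_basisP : strict_ordered_basis ccw_basis.
Proof.
have str x B B' : ccw_basis B -> ccw_basis B' -> carrier B x -> carrier B' x ->
    exists B'', [/\ ccw_basis B'', carrier B'' x, sub_str B'' B & sub_str B'' B'].
  move=> [U [hU [oU ->]]] [V [hV [oV ->]]] Ux Vx.
  have hUV : ccw_order (U `&` V) by apply: (ccw_orderS _ hU) => ? [].
  exists (ccw_poset hUV); split=> //.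
  - by exists (U `&` V), hUV; split=> //; exact: openI.
  - by apply: ccw_poset_str => ? [].
  - by apply: ccw_poset_str => ? [].
split=> //; split; last first.
  move=> x B B' h h' Bx B'x; have [B'' [? ? ? ?]] := str x B B' h h' Bx B'x.
  by exists B''; split=> //; exact: sub_str_lax.
split=> [_ [_ [U [hU [oU ->]]] <-] //|p V pV].
have [U [hU oU Up]] := ccw_order_locally p.
have hUV : ccw_order (U `&` V^°) by apply: (ccw_orderS _ hU) => ? [].
exists (U `&` V^°); last by move=> ? [_]; exact: interior_subset.
split; last by split.
exists (ccw_poset hUV) => //; exists (U `&` V^°), hUV; split=> //.
by apply: openI => //; exact: open_interior.
Qed.

Definition ccw_plane : lospace := lospace_of ccw_basisP.1.

Lemma closed_ccw : closed [set z : plane * plane | ccw z.1 z.2].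
Proof.
have c11 : continuous (fun z : plane * plane => z.1.1) :=
  continuous_compT continuous_fst continuous_fst.
have c12 : continuous (fun z : plane * plane => z.1.2) :=
  continuous_compT continuous_fst continuous_snd.
have c21 : continuous (fun z : plane * plane => z.2.1) :=
  continuous_compT continuous_snd continuous_fst.
have c22 : continuous (fun z : plane * plane => z.2.2) :=
  continuous_compT continuous_snd continuous_snd.
have -> : [set z : plane * plane | ccw z.1 z.2] =
    ([set z | z.1.1 = z.2.1] `&` [set z | z.1.2 = z.2.2]) `|`
    ([set z | sqnorm z.1 = 1] `&` [set z | sqnorm z.2 = 1] `&`
     [set z | cross z.2 z.1 <= 0]).
  apply/seteqP; split=> -[[p1 p2] [q1 q2]]; rewrite /ccw /cross /=.
    by move=> [[-> ->]|[np nq c]]; [left|right; split=> //; lra].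
  by move=> [[-> ->]|[[np nq] c]]; [left|right; split=> //; lra].
apply: closedU.
  by apply: closedI; exact: cvg_closed_eq.
apply: closedI; first apply: closedI.
- apply: cvg_closed_eq; last by move=> ?; exact: cvg_cst.
  exact: (continuous_compT continuous_fst continuous_sqnorm).
- apply: cvg_closed_eq; last by move=> ?; exact: cvg_cst.
  exact: (continuous_compT continuous_snd continuous_sqnorm).
- apply: cvg_closed_le0 => z; rewrite /cross.
  by apply: (@cvgB _ R^o); apply: (@cvgM R); by [exact: c11|exact: c12|exact: c21|exact: c22].
Qed.

Lemma ccw_plane_category (strict nachbin hausdorff : bool) :
  lo_category strict nachbin hausdorff ccw_plane.
Proof.
split=> _.
- exists ccw_basis; last exact: ccw_basisP.
  exact: (lo_bases_of ccw_basisP.1).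
- apply: (locally_nachbin_basis (lo_bases_of ccw_basisP.1)).
  move=> _ [U [hU [oU ->]]]; apply: (nachbin_closed closed_ccw) => p q Up Uq.
  by split=> [[]|pq] //; split.
- apply: (@separated_hausdorff R) => -[p1 p2] [q1 q2] pq; congr pair.
    by apply: (pq fst) => z; exact: cvg_fst.
  by apply: (pq snd) => z; exact: cvg_snd.
Qed.

End ccw_plane.

(** * Cones over the zebra cylinder *)

Section cone.
Variables (R : realType) (d : nat -> R) (phi : R -> R).
Hypotheses (phi_cts : continuous phi)
  (phi_stripe : forall n x, stripe d n x -> phi x = 0 \/ phi x = 1).

Definition cone (z : zebra d) : ccw_plane R :=
  (phi (\val z.2) * circle_re z.1, phi (\val z.2) * circle_im z.1).

Lemma continuous_cone : continuous cone.
Proof.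
have cI : continuous (\val : set_type (unit_itv R) -> R).
  exact: initial_continuous.
have cphi : continuous (fun z : circle R * set_type (unit_itv R) => phi (\val z.2)).
  exact: (continuous_compT (continuous_compT continuous_snd cI) phi_cts).
have cre : continuous (fun z : circle R * set_type (unit_itv R) => circle_re z.1).
  exact: (continuous_compT continuous_fst (@continuous_circle_re R)).
have cim : continuous (fun z : circle R * set_type (unit_itv R) => circle_im z.1).
  exact: (continuous_compT continuous_fst (@continuous_circle_im R)).
move=> z; exact: (cvg_pair (@cvgM R _ _ _ _ _ _ _ (cphi z) (cre z))
  (@cvgM R _ _ _ _ _ _ _ (cphi z) (cim z))).
Qed.

Lemma arc_le_cross (a b : R) (s t : circle R) : b - a <= pi -> arc_le a b s t ->
  0 <= circle_re s * circle_im t - circle_im s * circle_re t.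
Proof.
move=> ba [x [y [/andP[ax xb] /andP[ay yb] -> -> xy]]].
rewrite /circle_re /circle_im /=.
have -> : cos x * sin y - sin x * cos y = sin (y - x) by rewrite sinB; ring.
by apply: sin_ge0_pi; apply/andP; split; lra.
Qed.

Lemma circle_sqnorm (s : circle R) : sqnorm (circle_re s, circle_im s) = 1.
Proof. by have [t [_ ->]] := circle_ptE 0 s; exact: cos2Dsin2. Qed.

(** An arc no longer than [pi] is needed for the cross product to compare the
    arguments correctly. *)
Lemma cone_ccw (a b : R) (hab : proper_arc a b) (O : set (set_type (unit_itv R)))
    (p q : zebra d) : b - a <= pi ->
  sle (zebra_poset d hab O) p q -> ccw (cone p) (cone q).
Proof.
case: p q => [s u] [t v] ba [_ _ /= [[st [<- [n /phi_stripe un]]]|[<- <-]]]; last by left.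
case: un => un; rewrite /cone /= un; first by left; rewrite !mul0r.
right; rewrite !mul1r !circle_sqnorm; split=> //.
exact: (arc_le_cross ba).
Qed.

Lemma cone_increasing (z : zebra d) : locally_increasing_at cone z.
Proof.
apply/(locally_increasing_atE _ _
  (lo_bases_of (zebra_basisP d).1) (lo_bases_of (ccw_basisP R).1)).
move=> _ [U [hU [oU ->]]] /= Uz.
have /(zebra_basisP d).1.1.2 [_ [[B BB <-] Bz] BU] : nbhs z (cone @^-1` U).
  by apply: continuous_cone; exact: open_nbhs_nbhs.
have [t [_ zt]] := circle_ptE 0 z.1.
(* Intersecting with a half circle gives [cone_ccw] a short enough arc. *)
have BB' : zebra_basis d (zebra_poset d (proper_pi2 t) setT).
  by exists (t - pi / 2), (t + pi / 2), (proper_pi2 t), setT; split=> //; exact: openT.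
have Bz' : carrier (zebra_poset d (proper_pi2 t) setT) z.
  split=> //=; rewrite zt; exists t => //=; rewrite in_itv /=.
  by have := @pi_gt0 R => ?; apply/andP; split; lra.
have [A [BA Az AB AB']] := (zebra_basisP d).1.2 z _ _ BB BB' Bz Bz'.
exists A; split=> // [_ [p Ap <-]|p q pq]; first by apply/BU/AB.1.
have [Ap Aq] := sle_carrier pq.
split; [exact/BU/AB.1|exact/BU/AB.1|].
by apply: cone_ccw (AB'.2 _ _ pq); lra.
Qed.

Definition cone_morphism : lomorphism (zebra d) (ccw_plane R) :=
  Lomorphism cone_increasing.

End cone.

Lemma ramp (R : realType) (a b : R) : a < b -> exists phi : R -> R,
  [/\ continuous phi, forall x, x <= a -> phi x = 0 & forall x, b <= x -> phi x = 1].
Proof.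
move=> ab; have ab0 : 0 < b - a by rewrite subr_gt0.
exists (fun x => Num.max 0 (Num.min 1 ((x - a) / (b - a)))); split.
- move=> x.
  apply: (@continuous_max _ _ (fun=> 0) (fun x => Num.min 1 ((x - a) / (b - a)))).
    exact: cvg_cst.
  apply: (@continuous_min _ _ (fun=> 1) (fun x => (x - a) / (b - a))).
    exact: cvg_cst.
  apply: (@cvgM R); last exact: cvg_cst.
  by apply: (@cvgB _ R^o); [exact: cvg_id|exact: cvg_cst].
- move=> x xa; apply/max_idPl; rewrite ge_min; apply/orP; right.
  by rewrite pmulr_lle0 ?invr_gt0 // subr_le0.
- move=> x bx; rewrite (min_idPl _) ?(max_idPr _) ?ler01 //.
  by rewrite ler_pdivlMr // mul1r lerD2r.
Qed.

(** * Collapsing the bottom circle collapses the low stripes *)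

Section collapse.
Variables (R : realType) (d : nat -> R) (Q : lospace)
  (q : lomorphism (zebra d) Q).
Local Notation I := (set_type (unit_itv R)).
Local Notation qt t u := (q (circle_pt t, u)).

Lemma nbhs_itv0 (O : set I) : open O -> O (itv0 R) ->
  exists2 e, 0 < e & forall u : I, \val u < e -> O u.
Proof.
move=> [V oV <-] /= V0; have /nbhs_ballP[e /= e0 eV] : nbhs (0 : R) V.
  exact: open_nbhs_nbhs.
exists e => // u ue; apply: eV; rewrite /ball /= sub0r normrN ger0_norm //.
by have := set_mem (valP u); rewrite /unit_itv /= in_itv /= => /andP[].
Qed.

(** Around each point of the bottom circle [q] is increasing from an ordered
    neighbourhood to [B]; the step length [e] and the height bound can be chosen
    uniformly because a period is compact. *)
Lemma stripes_step (B : subposet Q) BQ : lo_bases BQ -> BQ B ->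
  (forall s, carrier B (q (s, itv0 R))) ->
  exists2 e, 0 < e & forall (u : I) (n : option nat), \val u < e ->
    stripe d n (\val u) -> forall x y, 0 <= x <= 2 * pi -> x <= y <= x + e ->
    sle B (qt x u) (qt y u).
Proof.
move=> hBQ BQB Bs.
pose P (e x : R) := forall (u : I) (n : option nat), \val u < e ->
  stripe d n (\val u) -> forall y, x <= y <= x + e -> sle B (qt x u) (qt y u).
have local x : `[0, 2 * pi]%classic x -> \forall x' \near x & e \near 0^'+, P e x'.
  move=> _.
  have [_ [[a [b [hab [ O [ oO ->]]]]] [[/= x0 x0I x0x] O0] _ qle]] :=
    @lo_mapP _ _ q (circle_pt x, itv0 R) _ _ (lo_bases_of (zebra_basisP d).1)
      hBQ B BQB (Bs _).
  have [e e0 eO] := nbhs_itv0 oO O0.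
  move: x0I; rewrite in_itv /= => /andP[ax0 x0b].
  pose m := Num.min (x0 - a) (b - x0).
  have m0 : 0 < m by rewrite lt_min !subr_gt0 ax0.
  have [ma mb] : m <= x0 - a /\ m <= b - x0 by split; rewrite ge_min lexx ?orbT.
  (* The starting point moves by less than [m / 2] and the step is at most
     [m / 2], so that both ends stay in the arc. *)
  exists (ball x (m / 2), [set e' | 0 < e' < Num.min e (m / 2)]) => /=.
    split; first by apply: nbhsx_ballx; rewrite divr_gt0.
    exists (Num.min e (m / 2)); first by rewrite /= lt_min e0 divr_gt0.
    by move=> e' /=; rewrite sub0r normrN => + e'0; rewrite gtr0_norm // e'0 => ->.
  move=> [x' e'] [/=]; rewrite /ball /= ltr_norml lt_min.
  move=> /andP[x'1 x'2] /and3P[e'0 e'e e'm] u n ue un y /andP[xy ye].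
  have Ou : O u by apply: eO; exact: lt_trans e'e.
  (* The angle [x0] is the representative of [x] that lies between [a] and [b]. *)
  have shift t : circle_pt (t + (x0 - x)) = circle_pt t.
    have := circle_ptD (t - x) x0x.
    have -> : x0 + (t - x) = t + (x0 - x) by ring.
    by have -> : x + (t - x) = t by ring.
  have xI : a < x' + (x0 - x) < b by apply/andP; split; lra.
  have yI : a < y + (x0 - x) < b by apply/andP; split; lra.
  apply: qle; split=> /=.
  - by split=> //=; exists (x' + (x0 - x)); rewrite /= ?in_itv ?shift.
  - by split=> //=; exists (y + (x0 - x)); rewrite /= ?in_itv ?shift.
  - left; split; last by split=> //; exists n.
    by exists (x' + (x0 - x)), (y + (x0 - x)); split; rewrite ?shift ?lerD2r.
have [e /= e0 He] : \forall e \near 0^'+, `[0, 2 * pi]%classic `<=` P e.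
  exact: (compact_near_coveringP _).1 (@segment_compact R 0 (2 * pi)) _ _ P _ local.
have e20 : 0 < e / 2 by rewrite divr_gt0.
exists (e / 2) => // u n ue un x y x0 xy.
have /He : ball 0 e (e / 2).
  by rewrite /ball /= sub0r normrN gtr0_norm //; lra.
move=> /(_ e20 x); rewrite /= in_itv /= => /(_ x0 u n ue un y); exact.
Qed.

(** Finitely many steps lead from angle 0 to [pi] and from there to [2 * pi],
    which is the same point as 0: antisymmetry of [B] identifies the images. *)
Lemma stripes_collapse : (forall s, q (s, itv0 R) = q (circle_pt 0, itv0 R)) ->
  exists2 e, 0 < e & forall (u : I) (n : option nat), \val u < e ->
    stripe d n (\val u) -> qt 0 u = qt pi u.
Proof.
move=> qs; have [BQ BQo hBQ] := lo_basesP Q.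
have hBQ' : lo_bases BQ by rewrite hBQ; split=> //; split; exact: coarser_refl.
have [_ [[B BQB <-] B0] _] := BQo.1.2 (q (circle_pt 0, itv0 R)) setT filterT.
have [|e e0 step] := stripes_step hBQ' BQB; first by move=> s; rewrite qs.
exists e => // u n ue un.
have mono k x y : 0 <= x -> y <= 2 * pi -> x <= y <= x + k%:R * e ->
    sle B (qt x u) (qt y u).
  elim: k x => [|k IH] x x0 y2 /andP[xy yk].
    by apply: (step u n) => //; apply/andP; split; lra.
  have [yxe|yxe] := leP y (x + e).
    by apply: (step u n) => //; apply/andP; split; lra.
  apply: (@sle_trans _ B (qt (x + e) u)).
    by apply: (step u n) => //; apply/andP; split; lra.
  apply: IH => //; first lra.
  by move: yk; rewrite -natr1 => yk; apply/andP; split; lra.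
have p0 := @pi_gt0 R.
have mono' x y : 0 <= x -> x <= y -> y <= 2 * pi -> sle B (qt x u) (qt y u).
  move=> x0 xy y2; apply: (mono (Num.bound (2 * pi / e))) => //.
  have := archi_boundP (divr_ge0 (ltW (mulr_gt0 (ltr0Sn R 1) p0)) (ltW e0)).
  by rewrite ltr_pdivrMr // => h; apply/andP; split=> //; lra.
apply: (@sle_anti _ B); first by apply: mono'; lra.
have -> : circle_pt 0 = circle_pt (2 * pi) :> circle R.
  by apply/circle_ptP; rewrite cos0 sin0 mulr_natl cos2pi sin2pi.
by apply: mono'; lra.
Qed.

End collapse.

(** * The absence of a coequalizer *)

Theorem proposition4p2 (R : realType) (d : nat -> R)
    (d_itv : forall n : nat, 0 <= d n <= 1)
    (d_decr : decreasing_seq d)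
    (d_inf : inf (range d) = 0)
    (strict nachbin hausdorff : bool) :
  ~ exists (Q : lospace) (q : lomorphism (zebra d) Q),
      is_coequalizer (lo_category strict nachbin hausdorff)
        (zebra_i0 d) (zebra_c0 d) q.
Proof.
move=> [Q [q [_ qE quniv]]].
have d0 n : 0 <= d n by have /andP[] := d_itv n.
have dle n p : (d n <= d p) = (p <= n)%N by exact: d_decr.
have [e e0 qcollapse] := stripes_collapse qE.
have [n dn] : exists n, d n < e.
  have dinf : has_inf (range d).
    by split; [exists (d 0%N), 0%N|exists 0 => _ [n _ <-]].
  have [_ [n _ <-]] := inf_adherent e0 dinf.
  by rewrite d_inf add0r; exists n.
have [|phi [cphi phi0 phi1]] := @ramp R (d n.*2.+2) (d n.*2.+1).
  by rewrite ltNge dle ltnn.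
have phi_stripe m x : stripe d m x -> phi x = 0 \/ phi x = 1.
  case: m => [m|->]; last by left; exact: phi0.
  rewrite /= in_itv /= => /andP[mx xm]; have [mn|nm] := leqP m n.
    by right; apply: phi1; apply: le_trans mx; rewrite dle; lia.
  by left; apply: phi0; apply: (le_trans xm); rewrite dle; lia.
pose h := cone_morphism cphi phi_stripe.
have hE : h \o zebra_i0 d =1 h \o zebra_c0 d.
  by move=> s; rewrite /= /cone /= phi0 // !mul0r.
have [k [kq _]] := quniv _ h (ccw_plane_category _ _ _ _) hE.
have uP : d n.*2.+1 \in unit_itv R.
  by apply: mem_set; rewrite /unit_itv /= in_itv; exact: d_itv.
pose u : set_type (unit_itv R) := exist _ (d n.*2.+1) uP.
have := qcollapse u (Some n).
rewrite /= in_itv /= lexx dle leqnSn => /(_ _ isT) qu.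
have {qu} /(congr1 k) : q (circle_pt 0, u) = q (circle_pt pi, u).
  by apply: qu; apply: le_lt_trans dn; rewrite dle; lia.
rewrite -!/((k \o q) _) !kq /= /cone /= phi1 // !mul1r => /(congr1 fst) /=.
by rewrite /circle_re /= cos0 cospi; lra.
Qed.
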